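(* Let $k\ge 2$ be an integer. Let $A$ be a finitely generated group with undecidable membership problem in its $k$-th derived subgroup $A^{(k)}$, and let $B$ be a finitely generated non-perfect group (i.e. $B\neq B'$). Let $W=\{s_k\}$ be the word that defines the $k$-solvable product of groups. Then the $k$-solvable product $A\stackrel{w}{\ast}B$ has undecidable word problem.
   Context: Conventions: $[a,b]=aba^{-1}b^{-1}$. $F_\infty$ is the free group on countably many letters $\{x_i\}_{i\in\mathbb{N}}$. For a group $G$, $G^{(0)}=G$, $G^{(k+1)}=[G^{(k)},G^{(k)}]$, and $G'=G^{(1)}$. Words: $s_1(x_1,x_2):=[x_1,x_2]$ and recursively $s_k(x_1,\ldots,x_{2^k}):=[s_{k-1}(x_1,\ldots,x_{2^{k-1}}),\,s_{k-1}(x_{2^{k-1}+1},\ldots,x_{2^k})]$ for $k\ge 2$. Verbal subgroup: for a group $G$ and a nonempty set $W\subseteq F_\infty$, $W(G)$ is the subgroup of $G$ generated by all evaluations of the words of $W$ at elements of $G$; for $W=\{s_k\}$, $W(G)=G^{(k)}$. Verbal product: for groups $A,B$, let $[A,B]$ be the subgroup of the free product $A\ast B$ generated by the elements $[a,b]$ with $a\in A$, $b\in B$ (it is normal in $A\ast B$). The verbal product relative to $W$ is $A\stackrel{w}{\ast}B:=(A\ast B)/\bigl(W(A\ast B)\cap[A,B]\bigr)$. For $W=\{s_k\}$ it is called the $k$-solvable product. Decision problems: let $G=\langle x_1,\ldots,x_n\mid R\rangle$ be a group generated by finitely many elements and let $F_n$ be the free group on $x_1,\ldots,x_n$. $G$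 has decidable word problem if there is an algorithm which, given $w\in F_n$, returns $1$ if $w=1$ in $G$ and $0$ if not. If $H$ is a subgroup of $G$, $G$ has decidable membership problem in $H$ if there is an algorithm which, given $w\in F_n$, returns $1$ if (the image in $G$ of) $w$ lies in $H$ and $0$ if not. Undecidable means not decidable. *)

(* Defs.v *)
From HB Require Import structures.
From mathcomp Require Import all_boot.
From mathcomp Require Import boolp classical_sets.

Set Implicit Arguments.
Unset Strict Implicit.
Unset Printing Implicit Defensive.

Import Algebra.
Local Open Scope classical_set_scope.
Local Open Scope group_scope.
Local Open Scope quotient_scope.

(* This is the convention [x, y] = x y x^-1 y^-1; the library's [~ x, y] is
   x^-1 y^-1 x y. *)
Definition comm (G : groupType) (x y : G) : G := x * y * x^-1 * y^-1.

Record is_subgroup (G : groupType) (H : set G) : Prop := IsSubgroup {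
  subgroup1 : H 1;
  subgroupM : forall x y, H x -> H y -> H (x * y);
  subgroupV : forall x, H x -> H x^-1 }.

Definition is_normal (G : groupType) (H : set G) : Prop :=
  is_subgroup H /\ forall g x, H x -> H (g * x * g^-1).

Definition generated (G : groupType) (S : set G) : set G :=
  smallest (@is_subgroup G) S.

Definition generates (G : groupType) (n : nat) (g : 'I_n -> G) : Prop :=
  generated (range g) = setT.

Definition finitely_generated (G : groupType) : Prop :=
  exists (n : nat) (g : 'I_n -> G), generates g.

Definition comm_subgroup (G : groupType) (H K : set G) : set G :=
  generated [set z | exists x y, [/\ H x, K y & z = comm x y]].

Fixpoint derived (G : groupType) (k : nat) : set G :=
  if k is k'.+1 then comm_subgroup (@derived G k') (@derived G k') else setT.
Arguments derived G k : clear implicits.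

Lemma generated_subgroup (G : groupType) (S : set G) : is_subgroup (generated S).
Proof.
split=> [|x y Sx Sy|x Sx] H [sH SH]; first exact: subgroup1.
- by apply: subgroupM => //; [apply: Sx|apply: Sy].
- by apply: subgroupV => //; apply: Sx.
Qed.

Lemma sub_generated (G : groupType) (S : set G) : S `<=` generated S.
Proof. exact: sub_gen_smallest. Qed.

Lemma generated_min (G : groupType) (S H : set G) :
  is_subgroup H -> S `<=` H -> generated S `<=` H.
Proof. by move=> sH SH; apply: smallest_sub. Qed.

Lemma subgroupI (G : groupType) (H K : set G) :
  is_subgroup H -> is_subgroup K -> is_subgroup (H `&` K).
Proof.
move=> sH sK; split=> [|x y [? ?] [? ?]|x [? ?]].
- by split; apply: subgroup1.
- by split; apply: subgroupM.
- by split; apply: subgroupV.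
Qed.

Lemma conjgMl (G : groupType) (g x y : G) :
  g * (x * y) * g^-1 = (g * x * g^-1) * (g * y * g^-1).
Proof. by rewrite !mulgA mulgVK. Qed.

Lemma conjgVl (G : groupType) (g x : G) : g * x^-1 * g^-1 = (g * x * g^-1)^-1.
Proof. by rewrite !invgM invgK mulgA. Qed.

Lemma generated_conj (G : groupType) (S : set G) (g : G) :
  (forall x, S x -> generated S (g * x * g^-1)) ->
  forall x, generated S x -> generated S (g * x * g^-1).
Proof.
move=> Sg x.
apply: (@generated_min _ S [set x | generated S (g * x * g^-1)]) => //.
have sS := generated_subgroup S; split=> /= [|y z ? ?|y ?].
- by rewrite mulg1 mulgV; apply: (subgroup1 sS).
- by rewrite conjgMl; apply: (subgroupM sS).
- by rewrite conjgVl; apply: (subgroupV sS).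
Qed.

Record normalSubgroup (G : groupType) := NormalSubgroup {
  nsg_set : set G;
  nsg_normal : is_normal nsg_set }.

Section QuotientGroup.
Variables (G : groupType) (NN : normalSubgroup G).
Local Notation N := (nsg_set NN).

#[local] Lemma sN : is_subgroup N. Proof. by case: (nsg_normal NN). Qed.

#[local] Lemma nN g x : N x -> N (g * x * g^-1).
Proof. by case: (nsg_normal NN) => _; apply. Qed.

Definition coset_rel (x y : G) : bool := `[< N (x^-1 * y) >].

Fact coset_rel_refl : reflexive coset_rel.
Proof. by move=> x; apply/asboolP; rewrite mulVg; apply: (subgroup1 sN). Qed.

Fact coset_rel_sym : symmetric coset_rel.
Proof.
have H x y : coset_rel x y -> coset_rel y x.
  by move=> /asboolP/(subgroupV sN); rewrite invgM invgK => ?; apply/asboolP.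
by move=> x y; apply/idP/idP => /H.
Qed.

Fact coset_rel_trans : transitive coset_rel.
Proof.
move=> y x z /asboolP Nxy /asboolP Nyz; apply/asboolP.
by have := subgroupM sN Nxy Nyz; rewrite mulgA mulgK.
Qed.

Canonical coset_equiv := EquivRel coset_rel
  coset_rel_refl coset_rel_sym coset_rel_trans.

Definition quotient : Type := {eq_quot coset_rel}.
HB.instance Definition _ := Choice.on quotient.
HB.instance Definition _ := EqQuotient.on quotient.

Definition quot_proj (x : G) : quotient := \pi_quotient x.

Lemma quot_projP x y : quot_proj x = quot_proj y <-> N (x^-1 * y).
Proof.
rewrite /quot_proj; split=> [/eqP|Nxy].
  by rewrite piE => /asboolP.
by apply/eqP; rewrite piE; apply/asboolP.
Qed.

Lemma quot_proj_surj (u : quotient) : exists x, u = quot_proj x.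
Proof. by exists (repr u); rewrite /quot_proj reprK. Qed.

Definition quot_one : quotient := quot_proj 1.
Definition quot_inv (u : quotient) : quotient := quot_proj (repr u)^-1.
Definition quot_mul (u v : quotient) : quotient := quot_proj (repr u * repr v).

Lemma quot_projM x y : quot_mul (quot_proj x) (quot_proj y) = quot_proj (x * y).
Proof.
rewrite /quot_mul; apply/quot_projP.
have /quot_projP Nx : quot_proj (repr (quot_proj x)) = quot_proj x.
  by rewrite /quot_proj reprK.
have /quot_projP Ny : quot_proj (repr (quot_proj y)) = quot_proj y.
  by rewrite /quot_proj reprK.
move: (repr (quot_proj x)) (repr (quot_proj y)) Nx Ny => x' y' Nx Ny.
have := subgroupM sN Ny (nN y^-1 Nx).
by rewrite invgK invgM !mulgA mulgK.
Qed.

Lemma quot_projV x : quot_inv (quot_proj x) = quot_proj x^-1.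
Proof.
rewrite /quot_inv; apply/quot_projP.
have /quot_projP Nx : quot_proj x = quot_proj (repr (quot_proj x)).
  by rewrite /quot_proj reprK.
move: (repr (quot_proj x)) Nx => x' Nx.
by have := nN x Nx; rewrite mulgA mulgV mul1g invgK.
Qed.

Fact quot_mulA : associative quot_mul.
Proof.
move=> u v w; have [x ->] := quot_proj_surj u.
have [y ->] := quot_proj_surj v; have [z ->] := quot_proj_surj w.
by rewrite !quot_projM mulgA.
Qed.

Fact quot_mul1 : left_id quot_one quot_mul.
Proof. by move=> u; have [x ->] := quot_proj_surj u; rewrite quot_projM mul1g. Qed.

Fact quot_mul1r : right_id quot_one quot_mul.
Proof. by move=> u; have [x ->] := quot_proj_surj u; rewrite quot_projM mulg1. Qed.

Fact quot_mulV : left_inverse quot_one quot_inv quot_mul.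
Proof.
by move=> u; have [x ->] := quot_proj_surj u; rewrite quot_projV quot_projM mulVg.
Qed.

Fact quot_mulVr : right_inverse quot_one quot_inv quot_mul.
Proof.
by move=> u; have [x ->] := quot_proj_surj u; rewrite quot_projV quot_projM mulgV.
Qed.

HB.instance Definition _ := isGroup.Build quotient
  quot_mulA quot_mul1 quot_mul1r quot_mulV quot_mulVr.

Fact quot_proj_morphism : monoid_morphism quot_proj.
Proof. by split=> // x y; rewrite -quot_projM. Qed.

HB.instance Definition _ :=
  isUMagmaMorphism.Build G quotient quot_proj quot_proj_morphism.

End QuotientGroup.

Section FreeProduct.
Variables A B : groupType.

(* The congruence on words over the disjoint union of A and B that makes the
   inclusions of A and B morphisms. *)
Inductive fp_eqv : seq (A + B) -> seq (A + B) -> Prop :=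
| fp_refl u : fp_eqv u u
| fp_sym u v : fp_eqv u v -> fp_eqv v u
| fp_trans u v w : fp_eqv u v -> fp_eqv v w -> fp_eqv u w
| fp_cat u u' v v' : fp_eqv u u' -> fp_eqv v v' -> fp_eqv (u ++ v) (u' ++ v')
| fp_l1 : fp_eqv [:: inl 1] [::]
| fp_r1 : fp_eqv [:: inr 1] [::]
| fp_lM a a' : fp_eqv [:: inl a; inl a'] [:: inl (a * a')]
| fp_rM b b' : fp_eqv [:: inr b; inr b'] [:: inr (b * b')].

Definition fp_rel (u v : seq (A + B)) : bool := `[< fp_eqv u v >].

Fact fp_rel_refl : reflexive fp_rel.
Proof. by move=> u; apply/asboolP; apply: fp_refl. Qed.

Fact fp_rel_sym : symmetric fp_rel.
Proof. by move=> u v; apply/idP/idP => /asboolP/fp_sym H; apply/asboolP. Qed.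

Fact fp_rel_trans : transitive fp_rel.
Proof.
by move=> v u w /asboolP uv /asboolP vw; apply/asboolP/(fp_trans uv vw).
Qed.

Canonical fp_equiv := EquivRel fp_rel fp_rel_refl fp_rel_sym fp_rel_trans.

Definition free_product : Type := {eq_quot fp_rel}.
HB.instance Definition _ := Choice.on free_product.
HB.instance Definition _ := EqQuotient.on free_product.

Definition fp_class (u : seq (A + B)) : free_product := \pi_free_product u.

Lemma fp_classP u v : fp_class u = fp_class v <-> fp_eqv u v.
Proof.
rewrite /fp_class; split=> [/eqP|uv]; first by rewrite piE => /asboolP.
by apply/eqP; rewrite piE; apply/asboolP.
Qed.

Lemma fp_class_repr x : fp_class (repr x) = x.
Proof. by rewrite /fp_class reprK. Qed.

Lemma fp_repr u : fp_eqv (repr (fp_class u)) u.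
Proof. by apply/fp_classP; rewrite fp_class_repr. Qed.

Definition letter_inv (l : A + B) : A + B :=
  match l with inl a => inl a^-1 | inr b => inr b^-1 end.

Definition fp_winv (u : seq (A + B)) : seq (A + B) := rev (map letter_inv u).

Lemma fp_winv_cat u v : fp_winv (u ++ v) = fp_winv v ++ fp_winv u.
Proof. by rewrite /fp_winv map_cat rev_cat. Qed.

Lemma fp_winvl u : fp_eqv (fp_winv u ++ u) [::].
Proof.
elim: u => [|l u IH]; first exact: fp_refl.
rewrite -cat1s fp_winv_cat catA -(catA _ _ [:: l]).
apply: (fp_trans _ IH); apply: fp_cat (fp_refl _).
rewrite -[X in fp_eqv _ X]cats0; apply: fp_cat (fp_refl _) _.
case: l => x /=; rewrite /fp_winv /rev /=.
- by apply: fp_trans (fp_lM _ _) _; rewrite mulVg; apply: fp_l1.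
- by apply: fp_trans (fp_rM _ _) _; rewrite mulVg; apply: fp_r1.
Qed.

Lemma fp_winvK u : fp_winv (fp_winv u) = u.
Proof.
rewrite /fp_winv map_rev revK -map_comp map_id_in // => -[] x _ /=;
  by rewrite invgK.
Qed.

Lemma fp_winvr u : fp_eqv (u ++ fp_winv u) [::].
Proof. by have := fp_winvl (fp_winv u); rewrite fp_winvK. Qed.

Definition fp_one : free_product := fp_class [::].
Definition fp_inv (x : free_product) : free_product := fp_class (fp_winv (repr x)).
Definition fp_mul (x y : free_product) : free_product :=
  fp_class (repr x ++ repr y).

Lemma fp_mulE u v : fp_mul (fp_class u) (fp_class v) = fp_class (u ++ v).
Proof. by apply/fp_classP; apply: fp_cat; apply: fp_repr. Qed.

Fact fp_mulA : associative fp_mul.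
Proof.
move=> x y z; rewrite -(fp_class_repr x) -(fp_class_repr y) -(fp_class_repr z).
by rewrite !fp_mulE catA.
Qed.

Fact fp_mul1 : left_id fp_one fp_mul.
Proof. by move=> x; rewrite -(fp_class_repr x) fp_mulE. Qed.

Fact fp_mul1r : right_id fp_one fp_mul.
Proof. by move=> x; rewrite -(fp_class_repr x) fp_mulE cats0. Qed.

Fact fp_mulV : left_inverse fp_one fp_inv fp_mul.
Proof.
by move=> x; rewrite -[in X in fp_mul _ X](fp_class_repr x) fp_mulE;
  apply/fp_classP/fp_winvl.
Qed.

Fact fp_mulVr : right_inverse fp_one fp_inv fp_mul.
Proof.
by move=> x; rewrite -[in X in fp_mul X _](fp_class_repr x) fp_mulE;
  apply/fp_classP/fp_winvr.
Qed.

HB.instance Definition _ := isGroup.Build free_product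
  fp_mulA fp_mul1 fp_mul1r fp_mulV fp_mulVr.

Definition fp_inl (a : A) : free_product := fp_class [:: inl a].
Definition fp_inr (b : B) : free_product := fp_class [:: inr b].

Fact fp_inl_morphism : monoid_morphism fp_inl.
Proof.
split=> [|a a']; first exact/fp_classP/fp_l1.
by rewrite [RHS]fp_mulE; apply/fp_classP/fp_sym/fp_lM.
Qed.

Fact fp_inr_morphism : monoid_morphism fp_inr.
Proof.
split=> [|b b']; first exact/fp_classP/fp_r1.
by rewrite [RHS]fp_mulE; apply/fp_classP/fp_sym/fp_rM.
Qed.

HB.instance Definition _ :=
  isUMagmaMorphism.Build A free_product fp_inl fp_inl_morphism.
HB.instance Definition _ :=
  isUMagmaMorphism.Build B free_product fp_inr fp_inr_morphism.

Lemma fp_generated : generated (range fp_inl `|` range fp_inr) = setT.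
Proof.
apply/seteqP; split=> // x _; rewrite -(fp_class_repr x).
have sS := generated_subgroup (range fp_inl `|` range fp_inr).
elim: (repr x) => [|l u IH]; first exact: (subgroup1 sS).
rewrite -cat1s -fp_mulE; apply: (subgroupM sS) => //.
by apply: sub_generated; case: l => y; [left|right]; exists y.
Qed.

Lemma fp_ind (P : set free_product) :
  is_subgroup P -> (forall a, P (fp_inl a)) -> (forall b, P (fp_inr b)) ->
  forall x, P x.
Proof.
move=> sP Pl Pr x.
have : generated (range fp_inl `|` range fp_inr) x by rewrite fp_generated.
by apply: generated_min => // y [] [z _ <-].
Qed.

Definition cross_comm : set free_product :=
  comm_subgroup (range fp_inl) (range fp_inr).

End FreeProduct.
Arguments cross_comm A B : clear implicits.

(* Elements of the free group on X are given by words in the letters (x, e),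
   standing for x if e = false and for x^-1 if e = true; words are not required
   to be freely reduced, as reduction does not change evaluations. *)
Definition word (X : Type) : Type := seq (X * bool).

Definition weval (G : groupType) (X : Type) (g : X -> G) (w : word X) : G :=
  foldr (fun l x => (if l.2 then (g l.1)^-1 else g l.1) * x) 1 w.

Definition winv (X : Type) (w : word X) : word X :=
  rev [seq (l.1, ~~ l.2) | l <- w].

Definition wcomm (X : Type) (u v : word X) : word X :=
  u ++ v ++ winv u ++ winv v.

Definition wshift (m : nat) (w : word nat) : word nat :=
  [seq ((l.1 + m)%N, l.2) | l <- w].

(* The letters are numbered from 0, so that s_word k involves x_0, ...,
   x_(2^k - 1); starting from s_0 = x_0 gives s_1 = [x_0, x_1]. *)
Fixpoint s_word (k : nat) : word nat :=
  if k is k'.+1 then wcomm (s_word k') (wshift (2 ^ k') (s_word k'))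
  else [:: (0%N, false)].

Definition verbal_subgroup (W : set (word nat)) (G : groupType) : set G :=
  generated [set x | exists w (g : nat -> G), W w /\ x = weval g w].
Arguments verbal_subgroup W G : clear implicits.

Lemma weval_conj (G : groupType) (X : Type) (g : X -> G) (h : G) (w : word X) :
  weval (fun i => h * g i * h^-1) w = h * weval g w * h^-1.
Proof.
elim: w => [|l w IH] /=; first by rewrite mulg1 mulgV.
by rewrite IH conjgMl; case: l.2 => //; rewrite conjgVl.
Qed.

Lemma verbal_subgroup_normal (W : set (word nat)) (G : groupType) :
  is_normal (verbal_subgroup W G).
Proof.
split=> [|h]; first exact: generated_subgroup.
apply: generated_conj => _ [w [g [Ww ->]]]; apply: sub_generated.
by exists w, (fun i => h * g i * h^-1); rewrite weval_conj.
Qed.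

Lemma cross_comm_normal (A B : groupType) : is_normal (cross_comm A B).
Proof.
have sC : is_subgroup (cross_comm A B) by apply: generated_subgroup.
have gC a b : cross_comm A B (comm (fp_inl B a) (fp_inr A b)).
  by apply: sub_generated; exists (fp_inl B a), (fp_inr A b).
split=> // h.
set P := [set h | forall x, cross_comm A B x ->
  cross_comm A B (h * x * h^-1) /\ cross_comm A B (h^-1 * x * h)].
suff : P h by move=> Ph x /Ph[].
have half (g : free_product A B) :
    (forall a b, cross_comm A B (g * comm (fp_inl B a) (fp_inr A b) * g^-1)) ->
    forall x, cross_comm A B x -> cross_comm A B (g * x * g^-1).
  move=> gab x; apply: generated_conj => _ [_ [_ [[a _ <-] [b _ <-] ->]]].
  exact: gab.
have halfl a x : cross_comm A B x ->
    cross_comm A B (fp_inl B a * x * (fp_inl B a)^-1).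
  apply: half => a' b.
  have -> : fp_inl B a * comm (fp_inl B a') (fp_inr A b) * (fp_inl B a)^-1 =
      comm (fp_inl B (a * a')) (fp_inr A b) *
      (comm (fp_inl B a) (fp_inr A b))^-1.
    by rewrite gmulfM /comm !invgM !invgK !mulgA !mulgVK.
  by apply: (subgroupM sC) => //; apply: (subgroupV sC).
have halfr b x : cross_comm A B x ->
    cross_comm A B (fp_inr A b * x * (fp_inr A b)^-1).
  apply: half => a b'.
  have -> : fp_inr A b * comm (fp_inl B a) (fp_inr A b') * (fp_inr A b)^-1 =
      (comm (fp_inl B a) (fp_inr A b))^-1 *
      comm (fp_inl B a) (fp_inr A (b * b')).
    by rewrite gmulfM /comm !invgM !invgK !mulgA !mulgVK.
  by apply: (subgroupM sC) => //; apply: (subgroupV sC).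
apply: (@fp_ind A B P) => [|a|b].
- split=> [x Cx|u v Pu Pv x Cx|u Pu x /Pu[C1 C2]].
  + by rewrite invg1 !mulg1 mul1g.
  + have [/Pu[C1 _] _] := Pv _ Cx; have [_ C2] := Pu _ Cx.
    have [_ C3] := Pv _ C2; split; first by rewrite invgM !mulgA in C1 *.
    by rewrite invgM !mulgA in C3 *.
  + by rewrite invgK.
- move=> x Cx; split; first exact: halfl.
  by have := halfl a^-1 x Cx; rewrite gmulfV invgK.
- move=> x Cx; split; first exact: halfr.
  by have := halfr b^-1 x Cx; rewrite gmulfV invgK.
Qed.

Definition verbal_kernel (W : set (word nat)) (A B : groupType) :
    set (free_product A B) :=
  verbal_subgroup W (free_product A B) `&` cross_comm A B.
Arguments verbal_kernel W A B : clear implicits.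

Fact verbal_kernel_normal (W : set (word nat)) (A B : groupType) :
  is_normal (verbal_kernel W A B).
Proof.
have [sV nV] := verbal_subgroup_normal W (free_product A B).
have [sC nC] := cross_comm_normal A B.
split; first exact: subgroupI.
by move=> g x [Vx Cx]; split; [apply: nV|apply: nC].
Qed.

Definition verbal_product (W : set (word nat)) (A B : groupType) : groupType :=
  quotient (NormalSubgroup (verbal_kernel_normal W A B)).

Definition solvable_product (k : nat) (A B : groupType) : groupType :=
  verbal_product [set s_word k] A B.

(* Partial recursive functions.  A program is run on a list of arguments, an
   absent argument being read as 0. *)
Inductive prog : Type :=
| Zero
| Succ
| Proj of nat
| Comp of prog & seq prog
| Prec of prog & prog
| Mu of prog.

(* computes p v y: the program p, run on v, halts with output y. *)
Fixpoint computes (p : prog) (v : seq nat) (y : nat) : Prop :=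
  match p with
  | Zero => y = 0%N
  | Succ => y = (head 0%N v).+1
  | Proj i => y = nth 0%N v i
  | Comp f gs =>
      exists2 ys : seq nat,
        (fix computes_all (gs : seq prog) (ys : seq nat) : Prop :=
           match gs, ys with
           | [::], [::] => True
           | g :: gs', z :: ys' => computes g v z /\ computes_all gs' ys'
           | _, _ => False
           end) gs ys
        & computes f ys y
  | Prec f g =>
      (fix prec (n : nat) (y : nat) : Prop :=
         match n with
         | 0%N => computes f (behead v) y
         | n'.+1 =>
             exists2 z, prec n' z & computes g [:: n', z & behead v] y
         end) (head 0%N v) y
  | Mu f =>
      computes f (y :: v) 0%N /\
      forall i, (i < y)%N -> exists z, computes f (i :: v) z.+1
  end.

#[local] Fixpoint prog_nested_ind (P : prog -> Prop) (P0 : P Zero) (PS : P Succ)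
  (PP : forall i, P (Proj i))
  (PC : forall f gs, P f -> foldr (fun g => and (P g)) True gs -> P (Comp f gs))
  (PR : forall f g, P f -> P g -> P (Prec f g))
  (PM : forall f, P f -> P (Mu f)) (p : prog) : P p :=
  let ind := prog_nested_ind P0 PS PP PC PR PM in
  match p with
  | Zero => P0
  | Succ => PS
  | Proj i => PP i
  | Comp f gs => PC f gs (ind f)
      ((fix all_ind (gs : seq prog) : foldr (fun g => and (P g)) True gs :=
          match gs with [::] => I | g :: gs' => conj (ind g) (all_ind gs') end) gs)
  | Prec f g => PR f g (ind f) (ind g)
  | Mu f => PM f (ind f)
  end.

Lemma computes_functional (p : prog) (v : seq nat) (y y' : nat) :
  computes p v y -> computes p v y' -> y = y'.
Proof.
elim/prog_nested_ind: p v y y' => /= [v y y' -> ->|v y y' -> ->|i v y y' -> ->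
  |f gs IHf IHgs v y y' [ys gys fy] [ys' gys' fy']|f g IHf IHg v|f IHf v y y'] //.
- suff E : ys = ys' by rewrite -E in fy'; apply: IHf fy fy'.
  elim: gs IHgs ys ys' {fy fy'} gys gys' => [|g gs IH] /=.
    by move=> _ [|? ?] [|? ?].
  move=> [IHg /IH{}IH] [|z ys] [|z' ys'] //= [gz /IH E] [gz' /E ->].
  by rewrite (IHg _ _ _ gz gz').
- elim: (head 0%N v) => [|n IH] y y'; first exact: IHf.
  by move=> [z /IH zE gy] [z' /zE E gy']; rewrite -E in gy'; apply: IHg gy gy'.
- move=> [fy ltf] [fy' ltf']; case: (ltngtP y y') => // lt.
  + by have [z /(IHf _ _ _ fy)] := ltf' _ lt.
  + by have [z /(IHf _ _ _ fy')] := ltf _ lt.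
Qed.

(* Words over n letters and their inverses are numbered by reading them in
   bijective base 2n, the digits 1, ..., 2n being the letters
   x_0, x_0^-1, ..., x_(n-1), x_(n-1)^-1, least significant digit first. *)
Definition word_code (n : nat) (w : word 'I_n) : nat :=
  foldr (fun (l : 'I_n * bool) (c : nat) =>
    ((l.1 : nat).*2 + (l.2 : nat) + 1 + n.*2 * c)%N) 0%N w.

Lemma word_code_inj (n : nat) : injective (@word_code n).
Proof.
have digit (a b c c' : nat) : (a < n.*2 -> b < n.*2 ->
    a + 1 + n.*2 * c = b + 1 + n.*2 * c' -> a = b /\ c = c')%N.
  move=> an bn; rewrite !addn1 !addSn => -[].
  rewrite ![(_ + n.*2 * _)%N]addnC ![(n.*2 * _)%N]mulnC => E.
  have n0 : (0 < n.*2)%N by apply: leq_ltn_trans an.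
  split.
    by have := congr1 (modn^~ n.*2) E; rewrite !modnMDl !modn_small.
  by have := congr1 (divn^~ n.*2) E; rewrite !divnMDl // !divn_small // !addn0.
have bound (i : 'I_n) (e : bool) : (i.*2 + e < n.*2)%N.
  by case: e; rewrite ?addn1 ?addn0 ?ltn_Sdouble ?ltn_double.
elim=> [|[i e] u IH] [|[j f] v] //=; rewrite ?addn1 //.
rewrite -!(addn1 (_ + _)) => /(digit _ _ _ _ (bound i e) (bound j f)) [E /IH ->].
suff [-> ->] : i = j /\ e = f by [].
split; last by have := congr1 odd E; rewrite !oddD !odd_double; case: e f {E} => [] [].
by apply/val_inj; have := congr1 half E; rewrite ![(_.*2 + _)%N]addnC !half_bit_double.
Qed.

Definition decidable_words (n : nat) (L : set (word 'I_n)) : Prop :=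
  exists p : prog, forall w : word 'I_n,
    (L w -> computes p [:: word_code w] 1%N) /\
    (~ L w -> computes p [:: word_code w] 0%N).

Definition decidable_word_problem (G : groupType) (n : nat) (g : 'I_n -> G) :
    Prop :=
  decidable_words [set w | weval g w = 1].

Definition decidable_membership_problem (G : groupType) (n : nat)
    (g : 'I_n -> G) (H : set G) : Prop :=
  decidable_words [set w | H (weval g w)].

(* Main.v *)
Require Import Defs.
From mathcomp Require Import all_boot boolp classical_sets.

(** Write G = A * B and let b be an element of B outside B'. For every a in A, the
commutator [[a, b]] lies in [[A, B]], so it is trivial in the k-solvable product
iff it lies in the subgroup generated by the values of s_k, which is the k-th
derived subgroup of G ([verbal_s_word]). The point is that this happens iff a lies
in the k-th derived subgroup of A ([comm_inl_inr_derived]). Given this, a decision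
procedure for the word problem of the product decides membership in the k-th
derived subgroup of A: a word w in the generators of A is sent to a word that
represents [[w, b]], and this is computable on codes of words
([computable_wcomm]).

The if part of the equivalence is normality of the derived subgroups. For the only
if part, let N be the derived subgroup of G of index k - 1. By the Kurosh theorem,
a and b a b^-1 lie in different free factors of N when a is in N; a direct argument
replaces this. A cocycle c of A over the translation action of A on G / N, with
values in a group T, extends to a cocycle of G that is trivial on B (section
[Cocycle]). Elements of N act trivially on G / N, so evaluation of the extended
cocycle at the coset 1 is a morphism from N to T. If c takes its values in a
subgroup whose derived subgroup lies in K, the morphism sends the k-th derived
subgroup N' of G into K ([cocycle_derived]). Now suppose that c is trivial outside
the orbit of 1 under A. As k >= 2 and b is not in B', the coset of b^-1 is not in
this orbit, and the value at [[a, b]] is the value of c for a at the coset of a^-1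
([cocycle_comm]). If a lies in the derived subgroup of A of index k - 1, the
Kaloujnine-Krasner cocycle of a section of A over its image in G / N has for this
value a conjugate of a, and K is the k-th derived subgroup of A. Otherwise a
coboundary with values in B has the value b^-1 there, and K = B' excludes it. *)

(** * Commutators and derived subgroups *)

Section GroupTheory.
Set Implicit Arguments.
Unset Strict Implicit.
Unset Printing Implicit Defensive.
Import Algebra.
Local Open Scope classical_set_scope.
Local Open Scope group_scope.

Lemma comm_conj (G : groupType) (g x y : G) :
  g * comm x y * g^-1 = comm (g * x * g^-1) (g * y * g^-1).
Proof. by rewrite /comm -!conjgVl -!conjgMl. Qed.

Lemma commV (G : groupType) (x y : G) : (comm x y)^-1 = comm y x.
Proof. by rewrite /comm !invgM !invgK !mulgA. Qed.

Lemma commMl (G : groupType) (x x' y : G) :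
  comm (x * x') y = x * comm x' y * x^-1 * comm x y.
Proof. by rewrite /comm !invgM !mulgA !mulgVK. Qed.

Lemma commVl (G : groupType) (x y : G) :
  comm x^-1 y = x^-1 * (comm x y)^-1 * x^-1^-1.
Proof. by rewrite commV /comm !invgK !mulgA mulgVK. Qed.

Lemma gmulf_comm (G H : groupType) (f : G -> H) (x y : G) :
  {morph f : u v / u * v} -> f (comm x y) = comm (f x) (f y).
Proof.
move=> fM; have f1 : f 1 = 1 by apply: (@mulIg _ (f 1)); rewrite -fM !mul1g.
have fV u : f u^-1 = (f u)^-1.
  by apply: (@mulIg _ (f u)); rewrite -fM !mulVg.
by rewrite /comm !fM !fV.
Qed.

Lemma is_normal_generated (G : groupType) (S : set G) :
  (forall g x, S x -> S (g * x * g^-1)) -> is_normal (generated S).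
Proof.
move=> SJ; split; first exact: generated_subgroup.
by move=> g; apply: generated_conj => x /(SJ g); apply: sub_generated.
Qed.

Lemma derived_normal (G : groupType) k : is_normal (derived G k).
Proof.
elim: k => [|k [_ nk]]; first by split.
apply: is_normal_generated => g _ [x [y [Dx Dy ->]]].
by rewrite comm_conj; do 2 eexists; split; [exact: nk Dx|exact: nk Dy|].
Qed.

Lemma derived_subgroup (G : groupType) k : is_subgroup (derived G k).
Proof. by case: (derived_normal G k). Qed.

Lemma derivedS_sub (G : groupType) k : derived G k.+1 `<=` derived G k.
Proof.
have [sk nk] := derived_normal G k.
apply: generated_min => // _ [x [y [Dx Dy ->]]].
by apply: (subgroupM sk); [apply: nk|apply: (subgroupV sk)].
Qed.

Lemma derived_sub1 (G : groupType) k : (0 < k)%N -> derived G k `<=` derived G 1.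
Proof. by case: k => // k _; elim: k => // k IH x /derivedS_sub/IH. Qed.

Lemma is_subgroup_preimage (G H : groupType) (f : G -> H) (K : set H) :
  {morph f : x y / x * y} -> is_subgroup K -> is_subgroup (f @^-1` K).
Proof.
move=> fM sK; have f1 : f 1 = 1 by apply: (@mulIg _ (f 1)); rewrite -fM !mul1g.
split=> /= [|x y Kx Ky|x Kx]; first by rewrite f1; apply: subgroup1.
- by rewrite fM; apply: subgroupM.
- have -> : f x^-1 = (f x)^-1 by apply: (@mulIg _ (f x)); rewrite -fM !mulVg.
  exact: subgroupV.
Qed.

Lemma derived_morph (G H : groupType) (f : G -> H) k :
  {morph f : x y / x * y} -> derived G k `<=` f @^-1` derived H k.
Proof.
move=> fM; elim: k => // k IH; apply: generated_min.
  exact/is_subgroup_preimage/derived_subgroup.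
move=> _ [x [y [Dx Dy ->]]] /=; rewrite gmulf_comm //.
by apply: sub_generated; exists (f x), (f y); split=> //; apply: IH.
Qed.

(** If [S] is stable under conjugation, commutators of products of elements of
[S] are products of conjugates of commutators of elements of [S]. *)
Lemma comm_subgroup_generated (G : groupType) (S : set G) :
  (forall g x, S x -> S (g * x * g^-1)) ->
  comm_subgroup (generated S) (generated S) `<=`
  generated [set z | exists x y, [/\ S x, S y & z = comm x y]].
Proof.
move=> SJ; set C := [set z | _].
have [sC nC] : is_normal (generated C).
  apply: is_normal_generated => g _ [x [y [Sx Sy ->]]]; rewrite comm_conj.
  by do 2 eexists; split; [exact: SJ Sx|exact: SJ Sy|].
have centralizer y : is_subgroup [set x | generated C (comm x y)].
  split=> /= [|x x' Cx Cx'|x Cx].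
  - by rewrite /comm mul1g invg1 mulg1 mulgV; apply: (subgroup1 sC).
  - by rewrite commMl; apply: (subgroupM sC) => //; apply: nC.
  - rewrite commVl; apply: (nC x^-1); exact: (subgroupV sC).
apply: generated_min => // _ [x [y [Gx Gy ->]]].
apply: (generated_min (centralizer y)) Gx => s Ss /=.
rewrite -commV; apply: (subgroupV sC).
apply: (generated_min (centralizer s)) Gy => t St /=.
by apply: sub_generated; exists t, s.
Qed.

(** * Evaluation of words, and the verbal subgroup of [s_k] *)

Lemma weval_cat (G : groupType) X (g : X -> G) (u v : word X) :
  weval g (u ++ v) = weval g u * weval g v.
Proof. by elim: u => [|l u IH] /=; rewrite ?mul1g // IH mulgA. Qed.

Lemma weval_winv (G : groupType) X (g : X -> G) (u : word X) :
  weval g (winv u) = (weval g u)^-1.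
Proof.
elim: u => [|[x e] u IH] /=; first by rewrite invg1.
rewrite /winv /= rev_cons -cats1 weval_cat [weval g (rev _)]IH invgM /= mulg1.
by case: e; rewrite ?invgK.
Qed.

Lemma weval_wcomm (G : groupType) X (g : X -> G) (u v : word X) :
  weval g (wcomm u v) = comm (weval g u) (weval g v).
Proof. by rewrite /wcomm !weval_cat !weval_winv !mulgA. Qed.

Lemma weval_wshift (G : groupType) (g : nat -> G) m (u : word nat) :
  weval g (wshift m u) = weval (fun i => g (i + m)%N) u.
Proof. by elim: u => //= l u ->. Qed.

Lemma eq_in_weval (G : groupType) (X : eqType) (g h : X -> G) (u : word X) :
  (forall l, l \in u -> g l.1 = h l.1) -> weval g u = weval h u.
Proof.
elim: u => //= l u IH gh; rewrite IH => [|l' l'u].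
  by rewrite gh ?mem_head.
by apply: gh; rewrite inE l'u orbT.
Qed.

Lemma weval_morph (G H : groupType) (f : UMagmaMorphism.type G H) X
  (g : X -> G) (u : word X) : f (weval g u) = weval (f \o g) u.
Proof.
by elim: u => [|[x e] u IH] /=; rewrite ?gmulf1 // gmulfM IH; case: e; rewrite ?gmulfV.
Qed.

Lemma weval_subst (G : groupType) X Y (g : X -> G) (h : Y -> G)
    (phi : Y * bool -> word X) (w : word Y) :
  (forall l, weval g (phi l) = if l.2 then (h l.1)^-1 else h l.1) ->
  weval g (flatten [seq phi l | l <- w]) = weval h w.
Proof.
by move=> gphi; elim: w => //= l w IH; rewrite weval_cat IH gphi.
Qed.

Lemma generates_weval (G : groupType) n (g : 'I_n -> G) :
  generates g -> forall x, exists w, weval g w = x.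
Proof.
move=> gG x; have : generated (range g) x by rewrite gG.
apply: (@generated_min _ _ [set x | exists w, weval g w = x]).
  split=> /= [|_ _ [u <-] [v <-]|_ [u <-]]; first by exists [::].
  - by exists (u ++ v); rewrite weval_cat.
  - by exists (winv u); rewrite weval_winv.
by move=> _ [i _ <-]; exists [:: (i, false)] => /=; rewrite mulg1.
Qed.

Lemma s_word_letter k l : l \in s_word k -> (l.1 < 2 ^ k)%N.
Proof.
have inv_letter (u : word nat) (l' : nat * bool) :
    l' \in winv u -> exists2 l'', l'' \in u & l''.1 = l'.1.
  by rewrite mem_rev => /mapP[l'' ? ->]; exists l''.
elim: k l => [|k IH] l /=; first by rewrite inE => /eqP ->.
have shift l' : l' \in wshift (2 ^ k) (s_word k) -> (l'.1 < 2 ^ k.+1)%N.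
  by move=> /mapP[l'' /IH ? ->] /=; rewrite expnS mul2n -addnn ltn_add2r.
have low l' : l' \in s_word k -> (l'.1 < 2 ^ k.+1)%N.
  by move=> /IH lt; apply: leq_trans lt _; rewrite leq_exp2l.
rewrite /wcomm !mem_cat => /or4P[/low|/shift|/inv_letter[l' /low ? <-]|
  /inv_letter[l' /shift ? <-]] //.
Qed.

(** The values of [s_(k+1)] are the commutators of two values of [s_k], because
the two copies of [s_k] have disjoint sets of letters. *)
Lemma derived_sub_verbal (G : groupType) k :
  derived G k `<=` verbal_subgroup [set s_word k] G.
Proof.
elim: k => [|k IH].
  move=> x _; apply: sub_generated; exists (s_word 0), (fun=> x).
  by rewrite /= mulg1.
set S := [set x : G | exists w (g : nat -> G), [set s_word k] w /\ x = weval g w].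
have SJ g x : S x -> S (g * x * g^-1).
  by move=> [w [h [-> ->]]]; exists (s_word k), (fun i => g * h i * g^-1); rewrite weval_conj.
apply: generated_min; first exact: generated_subgroup.
move=> _ [x [y [/IH Sx /IH Sy ->]]].
have : comm_subgroup (generated S) (generated S) (comm x y).
  by apply: sub_generated; exists x, y.
move/(comm_subgroup_generated SJ).
apply: generated_min; first exact: generated_subgroup.
move=> _ [_ [_ [[_ [g [-> ->]]] [_ [h [-> ->]]] ->]]]; apply: sub_generated.
exists (s_word k.+1), (fun i => if (i < 2 ^ k)%N then g i else h (i - 2 ^ k)%N).
split=> //; rewrite weval_wcomm weval_wshift; congr comm.
  by apply: eq_in_weval => l /s_word_letter ->.
by apply: eq_in_weval => l _; rewrite ltnNge leq_addl addnK.
Qed.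

Lemma verbal_s_word (G : groupType) k :
  verbal_subgroup [set s_word k] G = derived G k.
Proof.
apply/seteqP; split; last exact: derived_sub_verbal.
apply: generated_min; first exact: derived_subgroup.
move=> _ [_ [g [-> ->]]]; elim: k g => //= k IH g.
rewrite weval_wcomm weval_wshift; apply: sub_generated.
by do 2 eexists; split; [exact: (IH g)|exact: (IH (fun i => g (i + 2 ^ k)%N))|].
Qed.

(** * Morphisms and cocycles on a free product *)

Section Lift.
Variables (A B T : groupType) (f : A -> T) (h : B -> T).
Hypotheses (fM : {morph f : x y / x * y}) (hM : {morph h : x y / x * y}).

(** The morphism on the free product that extends [f] and [h]. *)
Definition fp_lift_word (u : seq (A + B)) : T :=
  foldr (fun l x => match l with inl a => f a | inr b => h b end * x) 1 u.

Definition fp_lift (x : free_product A B) : T := fp_lift_word (repr x).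

Lemma fp_lift_word_cat u v :
  fp_lift_word (u ++ v) = fp_lift_word u * fp_lift_word v.
Proof. by elim: u => [|l u IH] /=; rewrite ?mul1g // IH mulgA. Qed.

Lemma fp_lift_word_eqv u v : fp_eqv u v -> fp_lift_word u = fp_lift_word v.
Proof.
elim=> //= [x y z _ -> _ -> //|x x' y y' _ E _ E'|||a a'|b b'].
- by rewrite !fp_lift_word_cat E E'.
- by rewrite mulg1; apply: (@mulIg _ (f 1)); rewrite -fM !mul1g.
- by rewrite mulg1; apply: (@mulIg _ (h 1)); rewrite -hM !mul1g.
- by rewrite !mulg1 fM.
- by rewrite !mulg1 hM.
Qed.

Lemma fp_lift_class u : fp_lift (fp_class u) = fp_lift_word u.
Proof. exact/fp_lift_word_eqv/fp_repr. Qed.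

Lemma fp_liftM : {morph fp_lift : x y / x * y}.
Proof.
move=> x y; rewrite -(fp_class_repr x) -(fp_class_repr y).
by rewrite [_ * _]fp_mulE !fp_lift_class fp_lift_word_cat.
Qed.

Lemma fp_lift_inl a : fp_lift (fp_inl B a) = f a.
Proof. by rewrite fp_lift_class /= mulg1. Qed.

Lemma fp_lift_inr b : fp_lift (fp_inr A b) = h b.
Proof. by rewrite fp_lift_class /= mulg1. Qed.

End Lift.

(** Each factor is a retract of the free product, by the morphism that kills the
other one; so it meets the derived subgroups of the free product in its own
derived subgroups. *)
Lemma derived_fp_inl (A B : groupType) k (a : A) :
  derived (free_product A B) k (fp_inl B a) <-> derived A k a.
Proof.
split=> [|Da].
  have M1 : {morph (fun=> 1 : A) : x y / (x : B) * y >-> x * y}.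
    by move=> *; rewrite mulg1.
  have Mi : {morph (@id A) : x y / x * y} by [].
  by move/(derived_morph (fp_liftM Mi M1)); rewrite /= fp_lift_inl.
have Ml : {morph @fp_inl A B : x y / x * y} by exact: gmulfM.
exact: (derived_morph Ml Da).
Qed.

Lemma derived_fp_inr (A B : groupType) k (a : A) (b : B) :
  derived (free_product A B) k (fp_inr A b * fp_inl B a) -> derived B k b.
Proof.
have M1 : {morph (fun=> 1 : B) : x y / (x : A) * y >-> x * y}.
  by move=> *; rewrite mulg1.
have Mi : {morph (@id B) : x y / x * y} by [].
move/(derived_morph (fp_liftM M1 Mi)).
by rewrite /= fp_liftM // fp_lift_inl // fp_lift_inr // mulg1.
Qed.

Section Cocycle.
Variables (A B T : groupType) (NN : normalSubgroup (free_product A B)).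
Local Notation G := (free_product A B).
Local Notation Q := (quotient NN).
Local Notation pi := (quot_proj NN).

Variable c : A -> Q -> T.
Hypothesis cM : forall a a' q, c (a * a') q = c a (pi (fp_inl B a') * q) * c a' q.

(** A cocycle of [A] over the left translation action of [A] on the quotient
[G / N] of [G = A * B], with values in [T], extends to a cocycle of [G] that is
trivial on [B]; equivalently, a morphism from [A] to the unrestricted wreath
product of [T] and [G / N] that lifts [A -> G / N] extends to [G]. *)
Fixpoint cocycle_word (u : seq (A + B)) (q : Q) : T :=
  if u is l :: u' then
    (if l is inl a then c a (pi (fp_class u') * q) else 1) * cocycle_word u' q
  else 1.

Definition cocycle (x : G) : Q -> T := cocycle_word (repr x).

Lemma cocycle_word_cat u v q :
  cocycle_word (u ++ v) q =
  cocycle_word u (pi (fp_class v) * q) * cocycle_word v q.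
Proof.
elim: u => [|l u IH] /=; rewrite ?mul1g // IH mulgA.
case: l => [a|b] //=; congr (c a _ * _ * _).
by rewrite -fp_mulE [pi (fp_mul _ _)]gmulfM mulgA.
Qed.

Lemma fp_class_nil : fp_class [::] = 1 :> G. Proof. by []. Qed.

Lemma cocycle_word_eqv u v : fp_eqv u v -> cocycle_word u =1 cocycle_word v.
Proof.
have c1 q : c 1 q = 1.
  have := cM 1 1 q; rewrite mul1g !gmulf1 mul1g => E.
  by apply: (@mulIg _ (c 1 q)); rewrite -E mul1g.
elim=> //= [x y _ E q|x y z _ E _ E' q|x x' y y' _ E uv E' q|q|q|a a' q|b b' q].
- by rewrite E.
- by rewrite E E'.
- by rewrite !cocycle_word_cat E E'; move/fp_classP: uv => ->.
- by rewrite c1 mulg1.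
- by rewrite mulg1.
- by rewrite cM mulg1 fp_class_nil !gmulf1 mul1g mulg1.
- by rewrite !mulg1.
Qed.

Lemma cocycle_class u : cocycle (fp_class u) =1 cocycle_word u.
Proof. exact/cocycle_word_eqv/fp_repr. Qed.

Lemma cocycleM x y q : cocycle (x * y) q = cocycle x (pi y * q) * cocycle y q.
Proof.
rewrite -(fp_class_repr x) -(fp_class_repr y) [_ * fp_class _]fp_mulE.
by rewrite !cocycle_class cocycle_word_cat.
Qed.

Lemma cocycle_inl a q : cocycle (fp_inl B a) q = c a q.
Proof. by rewrite cocycle_class /= mulg1 fp_class_nil gmulf1 mul1g. Qed.

Lemma cocycle_inr b q : cocycle (fp_inr A b) q = 1.
Proof. by rewrite cocycle_class /= mulg1. Qed.

Lemma cocycle_mem (H : set T) : is_subgroup H -> (forall a q, H (c a q)) ->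
  forall x q, H (cocycle x q).
Proof.
move=> sH Hc x q; rewrite /cocycle.
elim: (repr x) => [|[a|b] u IH] /=; first exact: subgroup1.
- by apply: subgroupM.
- by rewrite mul1g.
Qed.

(** The elements of [N] act trivially on [G / N], so that evaluating the cocycle
at [1] is a morphism on [N]. *)
Lemma cocycle_derived (H K : set T) :
  is_subgroup H -> is_subgroup K -> comm_subgroup H H `<=` K ->
  (forall a q, H (c a q)) ->
  forall x, comm_subgroup (nsg_set NN) (nsg_set NN) x -> K (cocycle x 1).
Proof.
move=> sH sK HK Hc; have [sN nN] := nsg_normal NN.
have piN x : nsg_set NN x -> pi x = 1.
  by move=> Nx; rewrite -[RHS](@gmulf1 _ _ pi); apply/esym/quot_projP; rewrite invg1 mul1g.
have psiM x y : nsg_set NN y -> cocycle (x * y) 1 = cocycle x 1 * cocycle y 1.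
  by move=> Ny; rewrite cocycleM piN // mulg1.
have psi1 : cocycle 1 1 = 1.
  have := psiM 1 1 (subgroup1 sN); rewrite mul1g => E.
  by apply: (@mulIg _ (cocycle 1 1)); rewrite -E mul1g.
have psiV x : nsg_set NN x -> cocycle x^-1 1 = (cocycle x 1)^-1.
  by move=> Nx; apply: (@mulIg _ (cocycle x 1)); rewrite -psiM // !mulVg.
suff sub : comm_subgroup (nsg_set NN) (nsg_set NN) `<=`
    [set x | nsg_set NN x /\ K (cocycle x 1)] by move=> x /sub[].
apply: generated_min.
  split=> /= [|x y [Nx Kx] [Ny Ky]|x [Nx Kx]].
  - by rewrite psi1; split; apply: subgroup1.
  - by rewrite psiM //; split; apply: subgroupM.
  - by rewrite psiV //; split; apply: subgroupV.
move=> _ [x [y [Nx Ny ->]]]; have NVx := subgroupV sN Nx.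
have NVy := subgroupV sN Ny; split.
  exact: (subgroupM sN (subgroupM sN (subgroupM sN Nx Ny) NVx) NVy).
rewrite /comm !psiM // !psiV //; apply: HK; apply: sub_generated.
by exists (cocycle x 1), (cocycle y 1); split=> //; apply: cocycle_mem.
Qed.

(** Only the letters [a] and [a^-1] of [[a, b]] contribute, the second one at a
point where the cocycle of [A] is trivial. *)
Lemma cocycle_comm a b :
  nsg_set NN (comm (fp_inl B a) (fp_inr A b)) ->
  (forall a', c a' (pi (fp_inr A b^-1)) = 1) ->
  cocycle (comm (fp_inl B a) (fp_inr A b)) 1 = c a (pi (fp_inl B a^-1)).
Proof.
move=> Nab cb.
have pi_b : pi (fp_inr A b * fp_inl B a^-1 * fp_inr A b^-1) = pi (fp_inl B a^-1).
  by apply/esym/quot_projP; rewrite -gmulfV invgK !mulgA !gmulfV.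
rewrite /comm -!gmulfV -!mulgA !cocycleM !cocycle_inl !cocycle_inr !mulg1 !mul1g.
by rewrite cb mulg1 mulgA pi_b.
Qed.

End Cocycle.

(** * Commutators of the two factors in the derived subgroups *)

Section SectionCocycle.
Variables (A B T : groupType) (NN : normalSubgroup (free_product A B)).
Local Notation Q := (quotient NN).
Local Notation pi := (quot_proj NN).

Variables (f : A -> T) (s : Q -> T).
Hypothesis fM : {morph f : x y / x * y}.

(** The coboundary of [s] twisted by the morphism [f] on the orbit of [1] under
[A], and the trivial cocycle on the other orbits. *)
Definition section_cocycle (a : A) (q : Q) : T :=
  if `[< exists a', pi (fp_inl B a') = q >]
  then (s (pi (fp_inl B a) * q))^-1 * f a * s q else 1.

Lemma section_cocycleM a a' q :
  section_cocycle (a * a') q =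
  section_cocycle a (pi (fp_inl B a') * q) * section_cocycle a' q.
Proof.
rewrite /section_cocycle; case: asboolP => [[x <-]|nq].
  case: asboolP => [_|[]]; last by exists (a' * x); rewrite !gmulfM.
  by rewrite !gmulfM fM !mulgA mulgK.
case: asboolP => [[x E]|_]; last by rewrite mulg1.
case: nq; exists (a'^-1 * x); rewrite -[q](mulKg (pi (fp_inl B a'))) -E.
by rewrite !gmulfM !gmulfV.
Qed.

Lemma section_cocycleE a a' :
  section_cocycle a (pi (fp_inl B a')) =
  (s (pi (fp_inl B (a * a'))))^-1 * f a * s (pi (fp_inl B a')).
Proof.
rewrite /section_cocycle; case: asboolP => [_|[]]; last by exists a'.
by rewrite !gmulfM.
Qed.

End SectionCocycle.

(** With [G = A * B] and [N] the derived subgroup of [G] of index [k - 1], the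
nontrivial implication evaluates at [[a, b]], for two choices of the cocycle, the
morphism from [N] given by [cocycle_derived]. *)
Lemma comm_inl_inr_derived (A B : groupType) k (a : A) (b : B) :
  (2 <= k)%N -> ~ derived B 1 b ->
  derived (free_product A B) k (comm (fp_inl B a) (fp_inr A b)) <-> derived A k a.
Proof.
case: k => // k k1 B'b; set G := free_product A B.
have [sG nG] := derived_normal G k.+1.
split=> [Gab|Aa]; last first.
  have Ga : derived G k.+1 (fp_inl B a) by apply/derived_fp_inl.
  rewrite /comm -!mulgA; apply: (subgroupM sG) => //; rewrite mulgA.
  by apply: nG; apply: (subgroupV sG).
pose NN := NormalSubgroup (derived_normal G k).
pose pi := quot_proj NN.
have piM x y : pi (fp_inl B (x * y)) = pi (fp_inl B x) * pi (fp_inl B y).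
  by rewrite /pi !gmulfM.
have pi_inl x y : pi (fp_inl B x) = pi (fp_inl B y) <-> derived A k (x^-1 * y).
  by rewrite -(derived_fp_inl B) gmulfM gmulfV; apply: quot_projP.
have pi_b x : pi (fp_inl B x) <> pi (fp_inr A b^-1).
  move/esym/quot_projP; rewrite -gmulfV invgK.
  by move/derived_fp_inr/(derived_sub1 k1)/B'b.
have Nab : nsg_set NN (comm (fp_inl B a) (fp_inr A b)) by exact: derivedS_sub.
have cb (T : groupType) (f : A -> T) (s : quotient NN -> T) a' :
    section_cocycle f s a' (pi (fp_inr A b^-1)) = 1.
  by rewrite /section_cocycle; case: asboolP => // -[x /pi_b].
have [Aka|nAka] := pselect (derived A k a).
- (* A section [s] gives a cocycle of the identity of [A] whose values are in the
     derived subgroup of [A] of index [k - 1], and abelian modulo the next one;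
     its value at [[a, b]] is a conjugate of [a]. *)
  pose s q := xget (1 : A) [set x | pi (fp_inl B x) = q].
  have sK x : pi (fp_inl B (s (pi (fp_inl B x)))) = pi (fp_inl B x).
    by rewrite /s; case: xgetP => [y -> //|/(_ x)/(_ erefl)].
  have idM : {morph (@id A) : x y / x * y} by [].
  have cA x q : derived A k (section_cocycle id s x q).
    rewrite /section_cocycle; case: asboolP => [[y <-]|_]; last first.
      exact: (subgroup1 (derived_subgroup A k)).
    by rewrite -mulgA -piM; apply/pi_inl; rewrite sK !piM sK.
  have := cocycle_derived (section_cocycleM s idM) (derived_subgroup A k)
    (derived_subgroup A k.+1) (fun _ => id) cA Gab.
  rewrite (cocycle_comm (section_cocycleM s idM) Nab (cb _ _ _)).
  rewrite section_cocycleE mulgV.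
  have -> : quot_proj NN (fp_inl B a^-1) = quot_proj NN (fp_inl B 1).
    by apply/pi_inl; rewrite invgK mulg1.
  have [_ nA] := derived_normal A k.+1.
  move=> /(nA (s (pi (fp_inl B 1)))).
  by rewrite !mulgA mulgK mulgV mul1g.
- (* Now [a] acts nontrivially on [G / N], and the coboundary of an indicator
     function takes the value [b^-1] at [[a, b]]; any abelian group with a
     nontrivial element would do for the values, and [B / B'] is one. *)
  pose s (q : quotient NN) : B := if `[< q = 1 >] then b else 1.
  have f1M : {morph (fun _ : A => 1 : B) : x y / x * y} by move=> *; rewrite mulg1.
  have := cocycle_derived (section_cocycleM s f1M) (derived_subgroup B 0)
    (derived_subgroup B 1) (fun _ => id) (fun _ _ => I) Gab.
  rewrite (cocycle_comm (section_cocycleM s f1M) Nab (cb _ _ _)).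
  rewrite section_cocycleE mulgV mulg1 !gmulf1 /s.
  case: asboolP => // _; case: asboolP => [E|_].
    case: nAka; rewrite -[a]invgK -[a^-1^-1]mulg1; apply/pi_inl.
    by rewrite [LHS]E !gmulf1.
  by rewrite mulg1 => /(subgroupV (derived_subgroup B 1)); rewrite invgK => /B'b.
Qed.

End GroupTheory.

(** * Total computable functions *)

Section Computability.
Set Implicit Arguments.
Unset Strict Implicit.
Unset Printing Implicit Defensive.

Local Notation "v `_ i" := (nth 0 v i) : nat_scope.

(** A total function of a list of arguments, padded with zeros, is computable if
some program halts on every list with its value; for functions of at most three
arguments, only the first entries of the list count. *)
Definition computable (f : seq nat -> nat) : Prop :=
  exists p, forall v, computes p v (f v).
Definition computable1 (f : nat -> nat) := computable (fun v => f v`_0).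
Definition computable2 (f : nat -> nat -> nat) :=
  computable (fun v => f v`_0 v`_1).
Definition computable3 (f : nat -> nat -> nat -> nat) :=
  computable (fun v => f v`_0 v`_1 v`_2).

Lemma computable_ext f g : computable f -> f =1 g -> computable g.
Proof. by move=> [p pf] fg; exists p => v; rewrite -fg. Qed.

Lemma computable_nth i : computable (fun v => v`_i).
Proof. by exists (Proj i). Qed.

Lemma computable_comp f (gs : seq (seq nat -> nat)) :
  computable f -> foldr (fun g => and (computable g)) True gs ->
  computable (fun v => f [seq g v | g <- gs]).
Proof.
move=> [p pf] cgs.
suff [ps psP] : exists ps, forall v y, computes p [seq g v | g <- gs] y ->
    computes (Comp p ps) v y by exists (Comp p ps) => v; apply: psP.
suff [ps psP] : exists ps, forall v,
    (fix computes_all (qs : seq prog) (ys : seq nat) : Prop :=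
       match qs, ys with
       | [::], [::] => True
       | q :: qs', z :: ys' => computes q v z /\ computes_all qs' ys'
       | _, _ => False
       end) ps [seq g v | g <- gs].
  by exists ps => v y py; exists [seq g v | g <- gs]; first exact: psP.
elim: gs cgs {pf} => [_|g gs IH /= [[q qg] /IH[qs qsP]]]; first by exists [::].
by exists (q :: qs) => v; split; [exact: qg|exact: qsP].
Qed.

Lemma computable_comp1 h f :
  computable1 h -> computable f -> computable (fun v => h (f v)).
Proof. by move=> ch cf; apply: (computable_comp (gs := [:: f]) ch). Qed.

Lemma computable_comp2 h f g : computable2 h -> computable f -> computable g ->
  computable (fun v => h (f v) (g v)).
Proof. by move=> ch cf cg; apply: (computable_comp (gs := [:: f; g]) ch). Qed.

Lemma computable_comp3 h f g k :
  computable3 h -> computable f -> computable g -> computable k ->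
  computable (fun v => h (f v) (g v) (k v)).
Proof.
by move=> ch cf cg ck; apply: (computable_comp (gs := [:: f; g; k]) ch).
Qed.

Lemma computable_succ f : computable f -> computable (fun v => (f v).+1).
Proof. by apply: (@computable_comp1 S); exists Succ => v; rewrite /= -nth0. Qed.

Lemma computable_const k : computable (fun=> k).
Proof.
by elim: k => [|k IH]; [exists Zero|exact: (computable_succ IH)].
Qed.

Lemma computable_rec f g : computable f -> computable g ->
  computable (fun v => nat_rect (fun=> nat) (f (behead v))
    (fun i z => g [:: i, z & behead v]) v`_0).
Proof.
move=> [p pf] [q qg]; exists (Prec p q) => v /=; rewrite -nth0.
by elim: v`_0 => [|i IH] /=; [exact: pf|eexists; [exact: IH|exact: qg]].
Qed.

Lemma computable2_rec f g : computable1 f -> computable3 g ->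
  computable2 (fun N x => nat_rect (fun=> nat) (f x) (fun i z => g i z x) N).
Proof.
by move=> cf cg; apply: computable_ext (computable_rec cf cg) _ => v;
  rewrite /= !nth_behead.
Qed.

Lemma computable1_rec x0 g : computable2 g ->
  computable1 (nat_rect (fun=> nat) x0 g).
Proof.
move=> cg; apply: computable_ext (computable_rec (computable_const x0) cg) _.
by move=> v.
Qed.

(** * Computable arithmetic *)

Lemma computable_pred f : computable f -> computable (fun v => (f v).-1).
Proof.
apply: computable_comp1.
have := @computable1_rec 0 (fun i _ => i) (computable_nth 0).
by move=> c; apply: computable_ext c _ => v; case: v`_0.
Qed.

Lemma computable_add f g : computable f -> computable g ->
  computable (fun v => f v + g v).
Proof.
apply: computable_comp2.
have := @computable2_rec id (fun _ z _ => z.+1) (computable_nth 0)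
  (computable_succ (computable_nth 1)).
by move=> c; apply: computable_ext c _ => v; elim: v`_0 => //= i ->.
Qed.

Lemma computable_mul f g : computable f -> computable g ->
  computable (fun v => f v * g v).
Proof.
apply: computable_comp2.
have := @computable2_rec (fun=> 0) (fun _ z x => x + z) (computable_const 0)
  (computable_add (computable_nth 2) (computable_nth 1)).
by move=> c; apply: computable_ext c _ => v; elim: v`_0 => //= i ->; rewrite mulSn.
Qed.

Lemma computable_if0 c f g : computable c -> computable f -> computable g ->
  computable (fun v => if c v == 0 then f v else g v).
Proof.
apply: (computable_comp3 (h := fun c x y => if c == 0 then x else y)).
have := computable_rec (computable_nth 0) (computable_nth 3).
move=> h; apply: computable_ext h _ => v.
by rewrite !nth_behead /=; case: v`_0 => //= i; rewrite nth_behead.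
Qed.

(** Every function with finite support is computable. *)
Lemma computable_table D (f : nat -> nat) :
  computable1 (fun d => if d < D then f d else 0).
Proof.
elim: D f => [|D IH] f; first exact: computable_const.
have := computable_if0 (computable_nth 0) (computable_const (f 0))
  (computable_comp1 (IH (f \o S)) (computable_pred (computable_nth 0))).
by move=> h; apply: computable_ext h _ => v; case: v`_0.
Qed.

Lemma computable_modn D f : computable f -> computable (fun v => f v %% D).
Proof.
apply: (@computable_comp1 (modn^~ D)); case: (posnP D) => [->|D0].
  by apply: computable_ext (computable_nth 0) _ => v; rewrite modn0.
have := @computable1_rec 0 (fun _ z => if z < D then z.+1 %% D else 0)
  (computable_comp1
  (computable_table D (fun z => z.+1 %% D)) (computable_nth 1)).
move=> h; apply: computable_ext h _ => v.
elim: v`_0 => [|i /= ->]; first by rewrite mod0n.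
by rewrite ltn_pmod // -addn1 modnDml addn1.
Qed.

Lemma computable_divn D f : computable f -> computable (fun v => f v %/ D).
Proof.
apply: (@computable_comp1 (divn^~ D)); case: (posnP D) => [->|D0].
  by apply: computable_ext (computable_const 0) _ => v; rewrite divn0.
have := @computable1_rec 0 (fun i z => (if i.+1 %% D == 0 then 1 else 0) + z)
  (computable_add
  (computable_if0 (computable_modn D (computable_succ (computable_nth 0)))
    (computable_const 1) (computable_const 0)) (computable_nth 1)).
move=> h; apply: computable_ext h _ => v.
elim: v`_0 => [|i /= ->]; first by rewrite div0n.
by rewrite divnS // /dvdn; case: eqP.
Qed.

(** * Computable operations on codes of words *)

Lemma word_code_cat m (u v : word 'I_m) :
  word_code (u ++ v) = word_code u + m.*2 ^ size u * word_code v.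
Proof.
elim: u => [|l u IH] /=; first by rewrite mul1n.
by rewrite IH mulnDr addnA expnS mulnA.
Qed.

(** The number of the first letter of a word, and the code of the rest of it. *)
Definition word_head n (c : nat) := c.-1 %% n.*2.
Definition word_tail n (c : nat) := c.-1 %/ n.*2.

Lemma word_letter_bound n (l : 'I_n * bool) : l.1.*2 + l.2 < n.*2.
Proof.
case: l => i [] /=; last by rewrite addn0 ltn_double.
by rewrite addn1 ltn_Sdouble.
Qed.

Lemma word_head_code n (l : 'I_n * bool) w :
  word_head n (word_code (l :: w)) = l.1.*2 + l.2.
Proof.
rewrite /word_head /= addn1 addSn /= addnC mulnC modnMDl modn_small //.
exact: word_letter_bound.
Qed.

Lemma word_tail_code n (l : 'I_n * bool) w :
  word_tail n (word_code (l :: w)) = word_code w.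
Proof.
have lt := word_letter_bound l.
rewrite /word_tail /= addn1 addSn /= addnC mulnC divnMDl ?(leq_ltn_trans _ lt) //.
by rewrite divn_small // addn0.
Qed.

Lemma size_word_code n (w : word 'I_n) : size w <= word_code w.
Proof.
elim: w => //= l w IH; have lt := word_letter_bound l.
rewrite addn1 addSn ltnS (leq_trans IH) // (leq_trans _ (leq_addl _ _)) //.
by rewrite leq_pmull // (leq_ltn_trans _ lt).
Qed.

Section Pass.
Variables (n m : nat) (phi : 'I_n * bool -> word 'I_m).

(** The function of the number of a letter, [2 i] for [x_i] and [2 i + 1] for its
inverse, induced by a function of letters; it is 0 on other numbers. *)
Definition on_letter (F : 'I_n * bool -> nat) (d : nat) : nat :=
  if d < n.*2 then
    (if insub d./2 is Some i then F (i, odd d) else 0)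
  else 0.

Lemma on_letterE F (l : 'I_n * bool) : on_letter F (l.1.*2 + l.2) = F l.
Proof.
rewrite /on_letter word_letter_bound; case: l => i e /=.
by rewrite addnC half_bit_double valK oddD odd_double oddb addbF.
Qed.

(** Prepending the image of the first letter of the word coded by [c] to the
word coded by [x]. *)
Definition pass_step (x c : nat) : nat :=
  if c == 0 then x
  else on_letter (fun l => word_code (phi l)) (word_head n c) +
       on_letter (fun l => m.*2 ^ size (phi l)) (word_head n c) * x.

(** Reading the letters of the word coded by [c] from first to last, and
prepending their images to the word coded by [x]; [c] bounds the number of
letters. *)
Definition pass (c x : nat) : nat :=
  foldl pass_step x (traject (word_tail n) c c).

(** Images are prepended in the order of reading, so that they come out in the
reverse order. *)
Lemma pass_code (w : word 'I_n) (v : word 'I_m) :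
  pass (word_code w) (word_code v) =
  word_code (flatten [seq phi l | l <- rev w] ++ v).
Proof.
suff loop N : size w <= N -> foldl pass_step (word_code v)
    (traject (word_tail n) (word_code w) N) =
    word_code (flatten [seq phi l | l <- rev w] ++ v).
  exact/loop/size_word_code.
elim: w N v => [|l w IH] N v.
  have tail0 : word_tail n 0 = 0 by rewrite /word_tail div0n.
  by move=> _ /=; elim: N (word_code v) => //= N IH x; rewrite tail0 IH.
case: N => // N wN; rewrite trajectS word_tail_code /=.
have -> : pass_step (word_code v) (word_code (l :: w)) = word_code (phi l ++ v).
  rewrite /pass_step word_head_code !on_letterE word_code_cat.
  by rewrite [word_code (l :: w)]/= addn1 addSn.
by rewrite IH // rev_cons -cats1 map_cat flatten_cat /= cats0 -catA.
Qed.

Lemma computable_on_letter F f :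
  computable f -> computable (fun v => on_letter F (f v)).
Proof. exact/computable_comp1/computable_table. Qed.

Lemma computable_pass f g : computable f -> computable g ->
  computable (fun v => pass (f v) (g v)).
Proof.
apply: computable_comp2.
have c_tail f' : computable f' -> computable (fun v => word_tail n (f' v)).
  by move=> cf; apply/computable_divn/computable_pred.
have c_head f' : computable f' -> computable (fun v => word_head n (f' v)).
  by move=> cf; apply/computable_modn/computable_pred.
have c_iter : computable2 (fun i c => iter i (word_tail n) c).
  have h := @computable2_rec id (fun _ z _ => word_tail n z) (computable_nth 0)
    (c_tail _ (computable_nth 1)).
  by apply: computable_ext h _ => v; elim: v`_0 => //= i ->.
have c_step : computable2 pass_step.
  apply: computable_if0 (computable_nth 1) (computable_nth 0) _.
  have c_hd := c_head _ (computable_nth 1).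
  apply: computable_add (computable_on_letter _ c_hd) _.
  exact: computable_mul (computable_on_letter _ c_hd) (computable_nth 0).
have c_loop := computable_rec (computable_nth 1) (computable_comp2 c_step
  (computable_nth 1)
  (computable_comp2 c_iter (computable_nth 0) (computable_nth 2))).
have h := computable_comp (gs := [:: fun v => v`_0; fun v => v`_0; fun v => v`_1])
  c_loop (conj (computable_nth 0) (conj (computable_nth 0)
    (conj (computable_nth 1) I))).
apply: computable_ext h _ => v /=; rewrite /pass.
elim: {2 4}v`_0 => // N E.
by rewrite trajectSr foldl_rcons -E.
Qed.

End Pass.

(** Mapping the code of [w] to the code of the commutator of the image of [w]
under a substitution with a fixed word is computable, by three passes: one over
[w] with the inverted images, one over [w] that reverses it, and one over the
reversal of [w]. *)
Lemma computable_wcomm n m (phi : 'I_n * bool -> word 'I_m) (v : word 'I_m) :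
  exists2 f, computable1 f & forall w : word 'I_n,
    f (word_code w) = word_code (wcomm (flatten [seq phi l | l <- w]) v).
Proof.
pose f1 c := pass (fun l => winv (phi l)) c (word_code (winv v)).
pose f2 c := word_code v + m.*2 ^ size v * f1 c.
pose f3 c := pass (fun l : 'I_n * bool => [:: l]) c 0.
pose f c := pass phi (f3 c) (f2 c).
have c0 := computable_nth 0.
exists f => [|w].
  apply: computable_pass; first exact: computable_pass c0 (computable_const 0).
  apply: computable_add (computable_const _) (computable_mul (computable_const _) _).
  exact: computable_pass c0 (computable_const _).
have winv_flatten : winv (flatten [seq phi l | l <- w]) =
    flatten [seq winv (phi l) | l <- rev w].
  elim: w => //= l w IH; rewrite rev_cons -cats1 map_cat flatten_cat /= cats0 -IH.
  by rewrite /winv map_cat rev_cat.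
rewrite /f /f3 (pass_code _ _ [::]) cats0 flatten_seq1 /f2 /f1 pass_code.
by rewrite -word_code_cat pass_code revK /wcomm winv_flatten.
Qed.

Lemma decidable_words_preimage n m (f : nat -> nat) (h : word 'I_n -> word 'I_m)
    (L : set (word 'I_m)) :
  computable1 f -> (forall w, f (word_code w) = word_code (h w)) ->
  decidable_words L -> decidable_words [set w | L (h w)].
Proof.
move=> [q qf] fh [p pL]; exists (Comp p [:: q]) => w.
have qw : computes q [:: word_code w] (word_code (h w)).
  by rewrite -fh; exact: qf.
by have [L1 L0] := pL (h w); split=> [/L1|/L0] E; exists [:: word_code (h w)].
Qed.

End Computability.

(** * The word problem of the solvable product *)

Section SolvableProduct.
Set Implicit Arguments.
Unset Strict Implicit.
Unset Printing Implicit Defensive.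
Import Algebra.
Local Open Scope classical_set_scope.
Local Open Scope group_scope.

Variables (k : nat) (A B : groupType).

(** The projection of the free product onto the solvable product. *)
Definition solvable_proj : free_product A B -> solvable_product k A B :=
  quot_proj (NormalSubgroup (verbal_kernel_normal [set s_word k] A B)).

Lemma solvable_projM : {morph solvable_proj : x y / x * y}.
Proof. exact: gmulfM. Qed.

Lemma solvable_proj1 : solvable_proj 1 = 1.
Proof. exact: gmulf1. Qed.

Lemma solvable_proj_comm_eq1 (a : A) (b : B) :
  (2 <= k)%N -> ~ derived B 1 b ->
  solvable_proj (comm (fp_inl B a) (fp_inr A b)) = 1 <-> derived A k a.
Proof.
move=> k2 B'b; rewrite -(comm_inl_inr_derived a k2 B'b) -verbal_s_word.
rewrite -solvable_proj1.
split=> [/esym/quot_projP[]|Vab]; first by rewrite invg1 mul1g.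
apply/esym/quot_projP; rewrite invg1 mul1g; split=> //.
by apply: sub_generated; exists (fp_inl B a), (fp_inr A b).
Qed.

Lemma solvable_product_generated n (a : 'I_n -> A) m (b : 'I_m -> B) :
  generates a -> generates b ->
  generates (fun i : 'I_(n + m) => solvable_proj
    (match split i with inl j => fp_inl B (a j) | inr j => fp_inr A (b j) end)).
Proof.
move=> ga gb; set g := fun i => _; apply/seteqP; split=> // u _.
have [x ->] := quot_proj_surj u; rewrite -[quot_proj _ x]/(solvable_proj x).
have sg := generated_subgroup (range g).
have sgP := is_subgroup_preimage solvable_projM sg.
apply: (fp_ind sgP) x => [x|y].
- apply: (@generated_min A (range a)
    [set x | generated (range g) (solvable_proj (fp_inl B x))]).
  + have Ml : {morph @fp_inl A B : x y / x * y} by exact: gmulfM.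
    exact: is_subgroup_preimage Ml sgP.
  + move=> _ [i _ <-]; apply: sub_generated; exists (lshift m i) => //.
    by rewrite /g (unsplitK (inl i)).
  + by rewrite ga.
- apply: (@generated_min B (range b)
    [set y | generated (range g) (solvable_proj (fp_inr A y))]).
  + have Mr : {morph @fp_inr A B : x y / x * y} by exact: gmulfM.
    exact: is_subgroup_preimage Mr sgP.
  + move=> _ [i _ <-]; apply: sub_generated; exists (rshift n i) => //.
    by rewrite /g (unsplitK (inr i)).
  + by rewrite gb.
Qed.

(** Generators of [A], and [b], are fixed words in the generators [c]; substituting
them reduces membership of [w] in the derived subgroup to triviality of
[[w, b]]. *)
Lemma decidable_membership_derived n (a : 'I_n -> A) m
    (c : 'I_m -> solvable_product k A B) (b : B) :
  (2 <= k)%N -> ~ derived B 1 b -> generates c ->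
  decidable_word_problem c -> decidable_membership_problem a (derived A k).
Proof.
move=> k2 B'b gc decc.
have [v cv] := generates_weval gc (solvable_proj (fp_inr A b)).
have /choice[u cu] i := generates_weval gc (solvable_proj (fp_inl B (a i))).
pose phi (l : 'I_n * bool) := if l.2 then winv (u l.1) else u l.1.
have [f cf fE] := computable_wcomm phi v.
have := decidable_words_preimage cf fE decc; congr decidable_words.
apply/seteqP; suff E w : weval c (wcomm (flatten [seq phi l | l <- w]) v) = 1 <->
    derived A k (weval a w) by split=> w /= /E.
rewrite -(solvable_proj_comm_eq1 _ k2 B'b) weval_wcomm cv.
have -> : weval c (flatten [seq phi l | l <- w]) =
    solvable_proj (fp_inl B (weval a w)).
  rewrite (weval_morph (fp_inl B)) /solvable_proj (weval_morph (quot_proj _)).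
  by apply: weval_subst => -[i []] /=; rewrite /phi /= ?weval_winv cu.
by rewrite -(gmulf_comm _ _ solvable_projM).
Qed.

End SolvableProduct.

Theorem theorem4p3 (k : nat) (hk : 2 <= k) (A B : groupType)
    (n : nat) (a : 'I_n -> A) (ha : generates a)
    (hA : ~ decidable_membership_problem a (derived A k))
    (hBfg : finitely_generated B) (hB : derived B 1 <> setT) :
  finitely_generated (solvable_product k A B) /\
  forall (m : nat) (c : 'I_m -> solvable_product k A B), generates c ->
    ~ decidable_word_problem c.
Proof.
split=> [|m c gc decc].
  have [m [b hb]] := hBfg.
  by exists (n + m); eexists; exact: (solvable_product_generated k ha hb).
have [b B'b] : exists b, ~ derived B 1 b.
  apply/not_existsP => B'; apply: hB; apply/seteqP; split=> // b _.
  exact: contrapT (B' b).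
exact: hA (decidable_membership_derived a hk B'b gc decc).
Qed.
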